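(* Let $\Gamma=(V,E)$ be a connected graph with no sources. Then $\mathbf{Diag}(\Gamma)\simeq\boldsymbol{\mu}_N$ as affine group schemes over $\mathbb{F}$, where $N=2^{\mathrm{b}(\Gamma)}-1$.
   Context: $\mathbb{F}$ is a field of arbitrary characteristic, $\mathrm{Alg}_{\mathbb{F}}$ is the category of unital commutative associative $\mathbb{F}$-algebras; an affine group scheme is a representable functor $\mathrm{Alg}_{\mathbb{F}}\to\mathrm{Grp}$. $\boldsymbol{\mu}_N(R)=\{r\in R\mid r^N=1\}$. Graphs are finite directed graphs $\Gamma=(V,E)$, $E\subseteq V\times V$ (loops allowed). A vertex $v$ is a source if there is no $w\in V$ with $(w,v)\in E$. A path is a sequence $\gamma=(v_0,e_1,v_1,\ldots,v_{n-1},e_n,v_n)$ with $n\geq0$, $v_i\in V$, $e_i\in E$, and for each $i=1,\ldots,n$ either $e_i=(v_{i-1},v_i)$ or $e_i=(v_i,v_{i-1})$. It is a cycle if $v_0=v_n$. $\Gamma$ is connected if it is nonempty and any two vertices are joined by a path (i.e. the underlying undirected graph is connected). The balance $\mathrm{b}(\gamma)\in\mathbb{Z}$ is the number of $i$ for which $e_i$ is traversed in the right direction ($e_i=(v_{i-1},v_i)$; a loop $e_i=(v,v)$ is counted here) minus the number of $i$ for which $e_i$ is traversed in the wrong direction ($e_i=(v_i,v_{i-1})$ with $v_{i-1}\neq v_i$). The balance of $\Gamma$ is $\mathrm{b}(\Gamma)=\gcd\{|\mathrm{b}(\gamma)|:\gamma\text{ a cycle in }\Gamma\}$. The diagonal group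 of $\Gamma$ is the affine group scheme $\mathbf{Diag}(\Gamma)(R)=\{\varphi:V\to R^\times\mid\varphi(w)=\varphi(v)^2\ \text{for all}\ (v,w)\in E\}$, with pointwise multiplication and the natural action on morphisms. *)

(* Defs.v *)
From HB Require Import structures.
From mathcomp Require Import all_boot all_order all_algebra.
From mathcomp Require Import boolp.

Set Implicit Arguments.
Unset Strict Implicit.
Unset Printing Implicit Defensive.

Import GRing.Theory.

Local Open Scope ring_scope.

(* MathComp's comAlgType excludes the zero ring, which is an object of Alg_F.
   Hence a commutative unital F-algebra is taken here to be a commutative
   ring, possibly zero, with a ring morphism from F. *)
Record comm_alg (F : fieldType) := CommAlg {
  alg_ring :> comPzRingType;
  alg_map : {rmorphism F -> alg_ring}
}.

Record alg_hom (F : fieldType) (A B : comm_alg F) := AlgHom {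
  hom_fun :> {rmorphism A -> B};
  hom_alg : forall c : F, hom_fun (alg_map A c) = alg_map B c
}.

Section AlgHom.
Variable F : fieldType.

Lemma alg_hom_ext (A B : comm_alg F) (f g : alg_hom A B) : f =1 g -> f = g.
Proof.
case: f g => [[f [[fN] [fM]]] fA] [[g [[gN] [gM]]] gA] /= /funext fg.
case: _ / fg in gN gM gA *.
case: _ / (Prop_irrelevance fN gN) in gA *.
case: _ / (Prop_irrelevance fM gM) in gA *.
by rewrite (Prop_irrelevance fA gA).
Qed.

Definition alg_id (A : comm_alg F) : alg_hom A A :=
  @AlgHom F A A (idfun : {rmorphism A -> A}) (fun=> erefl).

Fact alg_comp_alg (A B C : comm_alg F) (g : alg_hom B C) (f : alg_hom A B)
  (c : F) : (g \o f) (alg_map A c) = alg_map C c.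
Proof. by rewrite /= !hom_alg. Qed.

Definition alg_comp (A B C : comm_alg F) (g : alg_hom B C) (f : alg_hom A B) :
    alg_hom A C :=
  @AlgHom F A C (g \o f : {rmorphism A -> C}) (alg_comp_alg g f).

End AlgHom.

Record group_functor (F : fieldType) := GroupFunctor {
  gobj :> comm_alg F -> groupType;
  gmap : forall A B : comm_alg F, alg_hom A B -> {multiplicative gobj A -> gobj B};
  gmap_id : forall (A : comm_alg F) (x : gobj A), gmap (alg_id A) x = x;
  gmap_comp : forall (A B C : comm_alg F) (g : alg_hom B C) (f : alg_hom A B)
    (x : gobj A), gmap (alg_comp g f) x = gmap g (gmap f x)
}.

Definition representable (F : fieldType) (G : group_functor F) : Prop :=
  exists (B : comm_alg F) (eta : forall A : comm_alg F, alg_hom B A -> G A),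
    (forall A : comm_alg F, bijective (eta A)) /\
    (forall (A A' : comm_alg F) (f : alg_hom A A') (h : alg_hom B A),
        eta A' (alg_comp f h) = gmap G f (eta A h)).

Record affine_group_scheme (F : fieldType) := AffineGroupScheme {
  ags_functor :> group_functor F;
  ags_representable : representable ags_functor
}.

Definition ags_isomorphic (F : fieldType) (G H : affine_group_scheme F) : Prop :=
  exists theta : forall A : comm_alg F, {multiplicative G A -> H A},
    (forall A : comm_alg F, bijective (theta A)) /\
    (forall (A A' : comm_alg F) (f : alg_hom A A') (x : G A),
        theta A' (gmap G f x) = gmap H f (theta A x)).

(* A group functor whose A-points are the solutions in A of a fixed system of
   polynomial equations is representable. *)
Module Presentation.
Section Presentation.
Variables (F : fieldType) (X : Type).

Inductive term :=
  | Var of X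
  | Cst of F
  | Add of term & term
  | Opp of term
  | Mul of term & term.

Fixpoint eval (A : comm_alg F) (h : X -> A) (t : term) : A :=
  match t with
  | Var x => h x
  | Cst c => alg_map A c
  | Add s t => eval h s + eval h t
  | Opp s => - eval h s
  | Mul s t => eval h s * eval h t
  end.

HB.instance Definition _ := gen_eqMixin term.
HB.instance Definition _ := gen_choiceMixin term.

Lemma eval_hom (A B : comm_alg F) (f : alg_hom A B) (h : X -> A) t :
  eval (fun x => f (h x)) t = f (eval h t).
Proof.
elim: t => //= [c|s -> t ->|s ->|s -> t ->].
- by rewrite hom_alg.
- by rewrite rmorphD.
- by rewrite rmorphN.
- by rewrite rmorphM.
Qed.

Variable E : term -> term -> Prop.

Definition satisfies (A : comm_alg F) (h : X -> A) :=
  forall s t, E s t -> eval h s = eval h t.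

(* Congruence by semantic consequence; its quotient is the free commutative
   F-algebra on X modulo the equations in E. *)
Definition teq (s t : term) : bool :=
  `[< forall (A : comm_alg F) (h : X -> A), satisfies h -> eval h s = eval h t >].

Lemma teqP s t : reflect
  (forall (A : comm_alg F) (h : X -> A), satisfies h -> eval h s = eval h t)
  (teq s t).
Proof. exact: asboolP. Qed.

Fact teq_equiv : equiv_class_of teq.
Proof.
split=> [s|s t|t s u].
- exact/teqP.
- by apply/teqP/teqP => st A h hE; rewrite st.
- by move=> /teqP st /teqP tu; apply/teqP => A h hE; rewrite st ?tu.
Qed.

Canonical teq_equivRel := EquivRelPack teq_equiv.
Canonical teq_encModRel := defaultEncModRel teq.

Local Open Scope quotient_scope.

Definition pres := {eq_quot teq}.
HB.instance Definition _ := Choice.on pres.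

Definition pi (t : term) : pres := \pi_pres t.

Lemma piK s t : (pi s = pi t) <-> teq s t.
Proof. by split=> [/eqmodP|/eqmodP]. Qed.

Lemma teq_repr t : teq (repr (pi t)) t.
Proof. by apply/piK; rewrite /pi reprK. Qed.

Lemma pi_repr (b : pres) : pi (repr b) = b.
Proof. by rewrite /pi reprK. Qed.

Definition padd (a b : pres) := pi (Add (repr a) (repr b)).
Definition popp (a : pres) := pi (Opp (repr a)).
Definition pmul (a b : pres) := pi (Mul (repr a) (repr b)).

Lemma piD s t : pi (Add s t) = padd (pi s) (pi t).
Proof.
apply/piK/teqP => A h hE /=.
by rewrite !(teqP _ _ (teq_repr _) A h hE).
Qed.

Lemma piN s : pi (Opp s) = popp (pi s).
Proof.
apply/piK/teqP => A h hE /=.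
by rewrite !(teqP _ _ (teq_repr _) A h hE).
Qed.

Lemma piM s t : pi (Mul s t) = pmul (pi s) (pi t).
Proof.
apply/piK/teqP => A h hE /=.
by rewrite !(teqP _ _ (teq_repr _) A h hE).
Qed.

Lemma pi_surj (P : pres -> Prop) : (forall t, P (pi t)) -> forall b, P b.
Proof. by move=> Pt b; rewrite -(pi_repr b). Qed.

Ltac pres_tac := do ?[elim/pi_surj => ?];
  rewrite -?(piM, piD, piN); apply/piK/teqP => A h hE /=.

Fact paddA : associative padd. Proof. by pres_tac; rewrite addrA. Qed.
Fact paddC : commutative padd. Proof. by pres_tac; rewrite addrC. Qed.
Fact padd0 : left_id (pi (Cst 0)) padd.
Proof. by pres_tac; rewrite rmorph0 add0r. Qed.
Fact paddN : left_inverse (pi (Cst 0)) popp padd.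
Proof. by pres_tac; rewrite rmorph0 addNr. Qed.
Fact pmulA : associative pmul. Proof. by pres_tac; rewrite mulrA. Qed.
Fact pmulC : commutative pmul. Proof. by pres_tac; rewrite mulrC. Qed.
Fact pmul1 : left_id (pi (Cst 1)) pmul.
Proof. by pres_tac; rewrite rmorph1 mul1r. Qed.
Fact pmulDl : left_distributive pmul padd.
Proof. by pres_tac; rewrite mulrDl. Qed.

HB.instance Definition _ := GRing.isZmodule.Build pres paddA paddC padd0 paddN.
HB.instance Definition _ :=
  GRing.Zmodule_isComPzRing.Build pres pmulA pmulC pmul1 pmulDl.

Definition pres_cst (c : F) : pres := pi (Cst c).

Fact pres_cst_zmod : zmod_morphism pres_cst.
Proof.
move=> a b; rewrite [RHS](_ : _ = pi (Add (Cst a) (Opp (Cst b)))).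
  by apply/piK/teqP => A h hE /=; rewrite rmorphB.
by rewrite piD piN.
Qed.

Fact pres_cst_monoid : monoid_morphism pres_cst.
Proof.
split=> // a b; rewrite [RHS](_ : _ = pi (Mul (Cst a) (Cst b))).
  by apply/piK/teqP => A h hE /=; rewrite rmorphM.
by rewrite piM.
Qed.

HB.instance Definition _ := GRing.isZmodMorphism.Build F pres pres_cst pres_cst_zmod.
HB.instance Definition _ :=
  GRing.isMonoidMorphism.Build F pres pres_cst pres_cst_monoid.

Definition pres_alg : comm_alg F :=
  @CommAlg F pres (pres_cst : {rmorphism F -> pres}).

Definition generic (x : X) : pres_alg := pi (Var x).

Lemma eval_generic t : eval generic t = pi t.
Proof. by elim: t => //= [s -> t ->|s ->|s -> t ->]; rewrite ?piD ?piN ?piM. Qed.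

Lemma satisfies_generic : satisfies generic.
Proof.
by move=> s t Est; rewrite !eval_generic; apply/piK/teqP => A h; apply.
Qed.

Section Lift.
Variables (A : comm_alg F) (h : X -> A).
Hypothesis hE : satisfies h.

Definition lift (b : pres) : A := eval h (repr b).

Lemma lift_pi t : lift (pi t) = eval h t.
Proof. exact: (teqP _ _ (teq_repr t)). Qed.

Fact lift_zmod : zmod_morphism lift.
Proof.
move=> a b; rewrite [a - b](_ : _ = pi (Add (repr a) (Opp (repr b)))).
  by rewrite lift_pi.
by rewrite piD piN !pi_repr.
Qed.

Fact lift_monoid : monoid_morphism lift.
Proof.
split=> [|a b]; first by rewrite [LHS]lift_pi /= rmorph1.
by rewrite [LHS]lift_pi.
Qed.

HB.instance Definition _ := GRing.isZmodMorphism.Build pres A lift lift_zmod.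
HB.instance Definition _ := GRing.isMonoidMorphism.Build pres A lift lift_monoid.

Fact lift_alg c : lift (alg_map pres_alg c) = alg_map A c.
Proof. exact: lift_pi. Qed.

Definition lift_hom : alg_hom pres_alg A :=
  @AlgHom F pres_alg A (lift : {rmorphism pres -> A}) lift_alg.

End Lift.

Lemma presented_representable (G : group_functor F)
    (coord : forall A : comm_alg F, G A -> X -> A) :
    (forall (A B : comm_alg F) (f : alg_hom A B) (g : G A) x,
        coord B (gmap G f g) x = f (coord A g x)) ->
    (forall (A : comm_alg F) (g g' : G A), coord A g =1 coord A g' -> g = g') ->
    (forall (A : comm_alg F) (g : G A), satisfies (coord A g)) ->
    (forall (A : comm_alg F) (h : X -> A), satisfies h ->
        exists g : G A, coord A g =1 h) ->
  representable G.
Proof.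
move=> coord_nat coord_inj coordE coord_surj.
have [g0 g0E] := coord_surj _ _ satisfies_generic.
exists pres_alg, (fun A f => gmap G f g0); split=> [A|A A' f h]; last first.
  exact: gmap_comp.
have inj : injective (fun f : alg_hom pres_alg A => gmap G f g0).
  move=> f f' /= ff'; apply: alg_hom_ext; elim/pi_surj => t.
  rewrite -eval_generic -!eval_hom; congr eval; apply/funext => x.
  by rewrite -g0E -!coord_nat ff'.
have surj (g : G A) : {f : alg_hom pres_alg A | gmap G f g0 = g}.
  apply: cid; exists (lift_hom (coordE A g)); apply: coord_inj => x.
  by rewrite coord_nat g0E /generic [LHS]lift_pi.
exists (fun g => sval (surj g)) => [f|g]; last exact: (svalP (surj g)).
exact/inj/(svalP (surj _)).
Qed.

End Presentation.

Lemma eval_iter_mul (F : fieldType) (X : Type) (A : comm_alg F) (h : X -> A) x n :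
  eval h (iter n (Mul (Var F x)) (Cst X 1)) = h x ^+ n.
Proof. by elim: n => [|n IHn] /=; rewrite ?rmorph1 // IHn exprS. Qed.

End Presentation.

(* An element of A^* is encoded together with its inverse. *)
Record units (A : comPzRingType) := Units {
  unit_pair : A * A;
  unit_pairP : unit_pair.1 * unit_pair.2 == 1
}.

HB.instance Definition _ (A : comPzRingType) := [isSub for @unit_pair A].
HB.instance Definition _ (A : comPzRingType) := [Choice of units A by <:].

Definition uval (A : comPzRingType) (u : units A) : A := (unit_pair u).1.

Section Units.
Variable A : comPzRingType.
Implicit Types u v w : units A.

Lemma uvalV u : uval u * (unit_pair u).2 = 1.
Proof. exact/eqP/unit_pairP. Qed.

Lemma uval_inj : injective (@uval A).
Proof.
move=> u v uv; apply: val_inj => /=.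
rewrite [LHS]surjective_pairing [RHS]surjective_pairing.
congr pair; first exact: uv.
rewrite -[LHS]mulr1 -(uvalV v) -uv mulrA [_.2 * _]mulrC uvalV.
exact: mul1r.
Qed.

Fact units_oneP : (1 : A, 1 : A).1 * (1 : A, 1 : A).2 == 1.
Proof. by rewrite mulr1. Qed.
Definition units_one : units A := Units units_oneP.

Fact units_mulP u v :
  let p := (uval u * uval v, (unit_pair u).2 * (unit_pair v).2) in
  p.1 * p.2 == 1.
Proof. by rewrite /= mulrACA !uvalV mulr1. Qed.
Definition units_mul u v : units A := Units (units_mulP u v).

Fact units_invP u : let p := ((unit_pair u).2, uval u) in p.1 * p.2 == 1.
Proof. by rewrite /= mulrC uvalV. Qed.
Definition units_inv u : units A := Units (units_invP u).

Fact units_mulA : associative units_mul.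
Proof. by move=> u v w; apply: uval_inj; apply: mulrA. Qed.
Fact units_mul1g : left_id units_one units_mul.
Proof. by move=> u; apply: uval_inj; apply: mul1r. Qed.
Fact units_mulg1 : right_id units_one units_mul.
Proof. by move=> u; apply: uval_inj; apply: mulr1. Qed.
Fact units_mulVg : left_inverse units_one units_inv units_mul.
Proof. by move=> u; apply: uval_inj; rewrite /uval /= mulrC uvalV. Qed.
Fact units_mulgV : right_inverse units_one units_inv units_mul.
Proof. by move=> u; apply: uval_inj; rewrite /uval /= uvalV. Qed.

HB.instance Definition _ := isGroup.Build (units A)
  units_mulA units_mul1g units_mulg1 units_mulVg units_mulgV.

Lemma units_mulgC u v : (u * v = v * u)%g.
Proof. by apply: uval_inj; apply: mulrC. Qed.

Lemma uval1 : uval (1%g : units A) = 1.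
Proof. by []. Qed.

Lemma uvalM u v : uval (u * v)%g = uval u * uval v.
Proof. by []. Qed.

Lemma uvalX u n : uval (u ^+ n)%g = uval u ^+ n.
Proof. by elim: n => // n IHn; rewrite expgS exprS uvalM IHn. Qed.

Lemma unit_of (a b : A) : a * b = 1 -> exists u : units A, uval u = a.
Proof.
by move/eqP=> ab; exists (@Units A (a, b) ab).
Qed.

End Units.

Section UnitsMap.
Variables (A B : comPzRingType) (f : {rmorphism A -> B}).

Fact units_mapP (u : units A) :
  let p := (f (unit_pair u).1, f (unit_pair u).2) in p.1 * p.2 == 1.
Proof. by rewrite /= -rmorphM uvalV rmorph1. Qed.

Definition units_map (u : units A) : units B := Units (units_mapP u).

Lemma uval_map u : uval (units_map u) = f (uval u).
Proof. by []. Qed.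

Fact units_mapM : {morph units_map : u v / (u * v)%g}.
Proof. by move=> u v; apply: uval_inj; apply: rmorphM. Qed.

HB.instance Definition _ :=
  isMultiplicative.Build (units A) (units B) units_map units_mapM.

Lemma units_mapX u n : units_map (u ^+ n)%g = (units_map u ^+ n)%g.
Proof. by apply: uval_inj; rewrite uval_map !uvalX rmorphXn. Qed.

End UnitsMap.

(* For N > 0 the condition r^N = 1 makes r invertible, so that this is
   { r in R | r^N = 1 } (see mu_carrierP); for N = 0 it is the group R^*. *)
Definition mu_pred (N : nat) (A : comPzRingType) : pred (units A) :=
  [pred u : units A | uval u ^+ N == 1].
Arguments mu_pred N A u : clear implicits.

Record mu_type (N : nat) (A : comPzRingType) := Mu {
  mu_val : units A;
  _ : mu_pred N A mu_val
}.

HB.instance Definition _ (N : nat) (A : comPzRingType) := [isSub for @mu_val N A].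
HB.instance Definition _ (N : nat) (A : comPzRingType) := [Choice of mu_type N A by <:].

Fact mu_group_closed (N : nat) (A : comPzRingType) : group_closed (mu_pred N A).
Proof.
split=> [|u v]; rewrite !inE /=; first by rewrite uval1 expr1n.
rewrite -!uvalX -(uval1 A) !(inj_eq (@uval_inj A)) => /eqP uN /eqP vN.
have /commgP : commute u v by exact: units_mulgC.
by move=> _; rewrite expgMn ?expVgn ?uN ?vN ?invg1 ?mulg1 //; apply: units_mulgC.
Qed.

HB.instance Definition _ (N : nat) (A : comPzRingType) :=
  SubChoice_isSubGroup.Build (units A) (mu_pred N A) (mu_type N A)
    (mu_group_closed N A).

Lemma mu_carrierP (N : nat) (A : comPzRingType) (r : A) : (0 < N)%N ->
  (exists u : mu_type N A, uval (mu_val u) = r) <-> r ^+ N = 1.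
Proof.
case: N => // N _; split=> [[[u uN] /= <-]|rN]; first exact/eqP.
have [|u ur] := @unit_of A r (r ^+ N); first by rewrite -exprS.
have uN : mu_pred N.+1 A u by rewrite /mu_pred /= ur rN.
by exists (Mu uN).
Qed.

Section MuMap.
Variables (N : nat) (A B : comPzRingType) (f : {rmorphism A -> B}).

Fact mu_mapP (u : mu_type N A) : mu_pred N B (units_map f (mu_val u)).
Proof. by case: u => u /= /eqP uN; rewrite /mu_pred /= uval_map -rmorphXn uN rmorph1. Qed.

Definition mu_map (u : mu_type N A) : mu_type N B := Mu (mu_mapP u).

Fact mu_mapM : {morph mu_map : u v / (u * v)%g}.
Proof. by move=> u v; apply: val_inj; apply: units_mapM. Qed.

HB.instance Definition _ :=
  isMultiplicative.Build (mu_type N A) (mu_type N B) mu_map mu_mapM.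

End MuMap.

Definition mu_functor (F : fieldType) (N : nat) : group_functor F.
Proof.
refine (@GroupFunctor F (fun A => mu_type N A)
  (fun A B f => (mu_map f : {multiplicative mu_type N A -> mu_type N B})) _ _).
- by move=> A x; apply: val_inj; apply: uval_inj.
- by move=> A B C g f x; apply: val_inj; apply: uval_inj.
Defined.

Inductive mu_eqns (F : fieldType) (N : nat) : Presentation.term F bool -> Presentation.term F bool -> Prop :=
  | MuUnit : mu_eqns N (Presentation.Mul (Presentation.Var F true) (Presentation.Var F false)) (Presentation.Cst bool 1)
  | MuPow : mu_eqns N (iter N (Presentation.Mul (Presentation.Var F true)) (Presentation.Cst bool 1)) (Presentation.Cst bool 1).

Fact mu_representable (F : fieldType) (N : nat) : representable (mu_functor F N).
Proof.
pose coord (A : comm_alg F) (u : mu_functor F N A) (b : bool) : A :=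
  let p := unit_pair (mu_val u) in if b then p.1 else p.2.
apply: (@Presentation.presented_representable F bool (@mu_eqns F N) _ coord).
- by move=> A B f u [].
- by move=> A u v uv; apply: val_inj; apply: uval_inj; apply: (uv true).
- move=> A u s t [] /=; first by rewrite /coord uvalV rmorph1.
  by rewrite Presentation.eval_iter_mul rmorph1; case: u => u /= /eqP.
- move=> A h hE.
  have := hE _ _ (MuUnit F N); rewrite /= rmorph1 => /eqP hU.
  have := hE _ _ (MuPow F N); rewrite Presentation.eval_iter_mul /= rmorph1 => /eqP hN.
  have uN : mu_pred N A (@Units A (h true, h false) hU) by [].
  by exists (Mu uN) => -[].
Qed.

Definition mu (F : fieldType) (N : nat) : affine_group_scheme F :=
  AffineGroupScheme (mu_representable F N).

Record digraph := Digraph {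
  vertex :> finType;
  edge : rel vertex
}.

Section Digraph.
Variable G : digraph.

Definition is_source (v : G) : bool := ~~ [exists w : G, edge w v].

(* The path (v_0, e_1, v_1, ..., e_n, v_n) is represented by v_0 and the
   sequence of pairs (e_i, v_i). *)
Definition step : Type := ((G * G) * G)%type.

Fixpoint is_path (u : G) (p : seq step) : bool :=
  if p is (e, v) :: q then
    [&& edge e.1 e.2, (e == (u, v)) || (e == (v, u)) & is_path v q]
  else true.

Definition path_end (u : G) (p : seq step) : G := last u (map snd p).

Definition is_cycle (u : G) (p : seq step) : bool :=
  is_path u p && (path_end u p == u).

Definition connected : Prop :=
  (0 < #|G|)%N /\
  (forall u v : G, exists2 p : seq step, is_path u p & path_end u p = v).

Fixpoint path_balance (u : G) (p : seq step) : int :=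
  if p is (e, v) :: q then
    (e == (u, v))%:Z - ((e == (v, u)) && (u != v))%:Z + path_balance v q
  else 0.

End Digraph.

(* The gcd of a possibly infinite set of natural numbers: its greatest common
   divisor for divisibility (so that it is 0 if no element is positive). *)
Definition is_gcd_set (S : nat -> Prop) (d : nat) : Prop :=
  (forall m, S m -> (d %| m)%N) /\
  (forall c, (forall m, S m -> (c %| m)%N) -> (c %| d)%N).

Fact gcd_set_ex (S : nat -> Prop) : exists d, is_gcd_set S d.
Proof.
have [[m [Sm m_gt0]]|S0] := pselect (exists m, S m /\ (0 < m)%N); last first.
  exists 0%N; split=> [m Sm|c _]; last exact: dvdn0.
  by case: m Sm => // m Sm; case: S0; exists m.+1.
pose cd c := `[< forall m, S m -> (c %| m)%N >].
exists (\big[lcmn/1%N]_(c < m.+1 | cd c) c); split=> [k Sk|c cS].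
  by apply/dvdn_biglcmP => c /asboolP; apply.
have c_lt : (c < m.+1)%N by rewrite ltnS dvdn_leq // cS.
by apply: (@biglcmn_sup _ (Ordinal c_lt)) => //; apply/asboolP.
Qed.

Definition gcd_set (S : nat -> Prop) : nat := sval (cid (gcd_set_ex S)).

Lemma gcd_setP (S : nat -> Prop) : is_gcd_set S (gcd_set S).
Proof. exact: (svalP (cid (gcd_set_ex S))). Qed.

Definition balance (G : digraph) : nat :=
  gcd_set (fun m => exists (u : G) (p : seq (step G)),
    is_cycle u p /\ m = `|path_balance u p|%N).

Definition diag_pred (G : digraph) (A : comPzRingType) : pred {ffun G -> units A} :=
  [pred phi : {ffun G -> units A} |
    [forall v : G, forall w : G, edge v w ==> (phi w == phi v ^+ 2)%g]].
Arguments diag_pred G A phi : clear implicits.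

Record diag_type (G : digraph) (A : comPzRingType) := Diagonal {
  diag_val : {ffun G -> units A};
  _ : diag_pred G A diag_val
}.

HB.instance Definition _ (G : digraph) (A : comPzRingType) := [isSub for @diag_val G A].
HB.instance Definition _ (G : digraph) (A : comPzRingType) := [Choice of diag_type G A by <:].

Lemma diag_predP (G : digraph) (A : comPzRingType) (phi : {ffun G -> units A}) :
  reflect (forall v w : G, edge v w -> phi w = (phi v ^+ 2)%g)
    (diag_pred G A phi).
Proof.
apply: (iffP forallP) => phiE v; first by move=> w vw; apply/eqP/(implyP (forallP (phiE v) w)).
by apply/forallP => w; apply/implyP => vw; apply/eqP/phiE.
Qed.

Fact diag_group_closed (G : digraph) (A : comPzRingType) :
    group_closed (diag_pred G A).
Proof.
split=> [|phi psi]; first by apply/diag_predP => v w _; rewrite !ffunE expg1n.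
move=> /diag_predP phiE /diag_predP psiE; apply/diag_predP => v w vw.
rewrite !ffunE (phiE _ _ vw) (psiE _ _ vw) expgMn ?expVgn //.
exact: units_mulgC.
Qed.

HB.instance Definition _ (G : digraph) (A : comPzRingType) :=
  SubChoice_isSubGroup.Build {ffun G -> units A} (diag_pred G A) (diag_type G A)
    (diag_group_closed G A).

Section DiagMap.
Variables (G : digraph) (A B : comPzRingType) (f : {rmorphism A -> B}).

Fact diag_mapP (phi : diag_type G A) :
  diag_pred G B [ffun v => units_map f (diag_val phi v)].
Proof.
case: phi => phi /= /diag_predP phiE; apply/diag_predP => v w vw.
by rewrite !ffunE (phiE _ _ vw) units_mapX.
Qed.

Definition diag_map (phi : diag_type G A) : diag_type G B :=
  Diagonal (diag_mapP phi).

Fact diag_mapM : {morph diag_map : phi psi / (phi * psi)%g}.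
Proof.
move=> phi psi; apply: val_inj; apply/ffunP => v; rewrite !ffunE.
exact: units_mapM.
Qed.

HB.instance Definition _ :=
  isMultiplicative.Build (diag_type G A) (diag_type G B) diag_map diag_mapM.

End DiagMap.

Definition Diag_functor (F : fieldType) (G : digraph) : group_functor F.
Proof.
refine (@GroupFunctor F (fun A => diag_type G A)
  (fun A B f => (diag_map f : {multiplicative diag_type G A -> diag_type G B})) _ _).
- by move=> A x; apply: val_inj; apply/ffunP => v; apply: uval_inj; rewrite ffunE.
- by move=> A B C g f x; apply: val_inj; apply/ffunP => v; apply: uval_inj;
    rewrite !ffunE.
Defined.

Inductive diag_eqns (F : fieldType) (G : digraph) :
    Presentation.term F (G * bool) -> Presentation.term F (G * bool) -> Prop :=
  | DiagUnit v : diag_eqns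
      (Presentation.Mul (Presentation.Var F (v, true)) (Presentation.Var F (v, false))) (Presentation.Cst _ 1)
  | DiagEdge v w of edge v w : diag_eqns
      (Presentation.Var F (w, true)) (Presentation.Mul (Presentation.Var F (v, true)) (Presentation.Var F (v, true))).

Fact Diag_representable (F : fieldType) (G : digraph) :
  representable (Diag_functor F G).
Proof.
pose coord (A : comm_alg F) (phi : Diag_functor F G A) (x : G * bool) : A :=
  let p := unit_pair (diag_val phi x.1) in if x.2 then p.1 else p.2.
apply: (@Presentation.presented_representable F _ (@diag_eqns F G) _ coord).
- by move=> A B f phi [v []]; rewrite /coord /= ffunE.
- move=> A phi psi e; apply: val_inj; apply/ffunP => v; apply: uval_inj.
  exact: (e (v, true)).
- move=> A phi s t [v|v w vw] /=; first by rewrite /coord /= uvalV rmorph1.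
  have phiE := elimT (diag_predP _) (valP phi).
  by rewrite /coord /= (phiE _ _ vw).
- move=> A h hE.
  have hU v : (h (v, true), h (v, false)).1 * (h (v, true), h (v, false)).2 == 1.
    by have := hE _ _ (DiagUnit F v); rewrite /= rmorph1 => /eqP.
  have phiP : diag_pred G A [ffun v => Units (hU v)].
    apply/diag_predP => v w vw; rewrite !ffunE; apply: uval_inj.
    by rewrite uvalX; apply: (hE _ _ (DiagEdge F vw)).
  by exists (Diagonal phiP) => -[v []]; rewrite /coord /= ffunE.
Qed.

Definition Diag (F : fieldType) (G : digraph) : affine_group_scheme F :=
  AffineGroupScheme (Diag_representable F G).

(* Main.v *)
(** Along an edge the label is squared, so the label at the end of a path of
    balance [b] is, up to square roots, the [2 ^ b]-th power of the label at
    its origin.  Walking backwards from a vertex of a finite graph without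
    sources must loop, so every label [x] satisfies [x ^ (2 ^ L) = x] for some
    [L > 0]: square roots of labels are unique, and by connectedness a
    labelling is determined by its value at a base point [r].  The exponents
    [k] with [x ^ (2 ^ k) = x], [x] being the label at [r], are the multiples
    of the least positive one, and that one divides the balance of every
    cycle, hence [balance G].  Conversely an element [x] of [mu] extends to
    the labelling [x ^ (2 ^ h v)], where [h v] is the balance modulo
    [balance G] of any path from [r] to [v]. *)

From HB Require Import structures.
Require Import Defs.
From mathcomp Require Import all_boot all_order all_algebra.
From mathcomp Require Import boolp zify.

Set Implicit Arguments.
Unset Strict Implicit.
Unset Printing Implicit Defensive.

Import Order.TTheory GRing.Theory Num.Theory.

Lemma path_end_cat (G : digraph) (u : G) p q :
  path_end u (p ++ q) = path_end (path_end u p) q.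
Proof. by rewrite /path_end map_cat last_cat. Qed.

Lemma is_path_cat (G : digraph) (u : G) p q :
  is_path u (p ++ q) = is_path u p && is_path (path_end u p) q.
Proof. by elim: p u => //= -[e v] p IHp u; rewrite IHp -!andbA. Qed.

Lemma path_balance_cat (G : digraph) (u : G) p q :
  path_balance u (p ++ q)
    = (path_balance u p + path_balance (path_end u p) q)%R.
Proof. by elim: p u => [|[e v] p IHp] u; rewrite /= ?add0r // IHp addrA. Qed.

Lemma dvdn_gcd_set (S : nat -> Prop) m : S m -> gcd_set S %| m.
Proof. exact: (gcd_setP S).1. Qed.

Lemma gcd_set_greatest (S : nat -> Prop) d :
  (forall m, S m -> d %| m) -> d %| gcd_set S.
Proof. exact: (gcd_setP S).2. Qed.

Lemma balance_dvdz_cycle (G : digraph) (u : G) p :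
  is_cycle u p -> (balance G %| path_balance u p)%Z.
Proof. by move=> cp; rewrite dvdzE; apply: dvdn_gcd_set; exists u, p. Qed.

(** Take [h v] to be the balance of a chosen path from [r] to [v]. For an edge from [v] to [w], go
    to [w] either directly or through [v], then close both paths by the same return [q]: the
    balances of these two cycles differ by [h w - (h v + 1)]. *)
Lemma potential_mod_balance (G : digraph) (r : G) : connected G ->
  exists h : G -> int, (balance G %| h r)%Z /\
    forall v w, edge v w -> (balance G %| (h w - (h v + 1))%R)%Z.
Proof.
case=> _ conn.
have /choice[p pP] v : exists p, is_path r p /\ path_end r p = v.
  by have [p] := conn r v; exists p.
exists (fun v => path_balance r (p v)); split=> [|v w vw].
  by have [? e] := pP r; apply: balance_dvdz_cycle; rewrite /is_cycle e eqxx andbT.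
have [[pv ev] [pw ew]] := (pP v, pP w); have [q pq eq_r] := conn w r.
have cyc_w : is_cycle r (p w ++ q).
  by rewrite /is_cycle is_path_cat path_end_cat pw ew pq eq_r /=.
have cyc_v : is_cycle r (p v ++ ((v, w), w) :: q).
  by rewrite /is_cycle is_path_cat path_end_cat pv ev /= vw eqxx pq -eq_r /=.
have := rpredB (balance_dvdz_cycle cyc_w) (balance_dvdz_cycle cyc_v).
rewrite !path_balance_cat ev ew /= eqxx xpair_eqE.
have -> : (v == w) && (w == v) && (v != w) = false by case: (v == w); rewrite ?andbF.
by rewrite subr0 addrA [X in (_ - X)%R]addrC addrKA.
Qed.

(** If the balance were 0, the potential would increase by exactly 1 along every edge, which is
    absurd at the edge entering a vertex of minimal potential. *)
Lemma balance_gt0 (G : digraph) : connected G ->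
  (forall v : G, ~~ is_source v) -> 0 < balance G.
Proof.
move=> connG nosrc; have [/card_gt0P[r _] _] := connG.
have [h [_ hE]] := potential_mod_balance r connG.
rewrite lt0n; apply/eqP => b0.
have [v _ hmin] := @Order.TotalTheory.arg_minP _ _ _ r xpredT h isT.
have /negPn/existsP[w wv] := nosrc v.
have := hE _ _ wv; rewrite b0 dvd0z => /eqP.
have := hmin w isT; lia.
Qed.

Definition squaring (G : digraph) (T : groupType) (phi : G -> T) :=
  forall v w : G, edge v w -> phi w = (phi v ^+ 2)%g.

Section Squaring.
Variables (G : digraph) (T : groupType).
Implicit Types phi psi : G -> T.

Lemma squaring_exp phi k : squaring phi -> squaring (fun v => phi v ^+ k)%g.
Proof. by move=> phiE v w /phiE ->; rewrite -!expgnA mulnC. Qed.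

Lemma squaring_periodic (v : G) : (forall v : G, ~~ is_source v) ->
  exists2 L, 0 < L & forall phi, squaring phi -> (phi v ^+ (2 ^ L) = phi v)%g.
Proof.
move=> nosrc.
have /choice[p pE] (w : G) : exists w', edge w' w by have /negPn/existsP := nosrc w.
have iterE phi : squaring phi ->
    forall n w, phi w = (phi (iter n p w) ^+ (2 ^ n))%g.
  move=> phiE; elim=> [|n IHn] w /=; first by rewrite expg1.
  by rewrite IHn (phiE _ _ (pE _)) -expgnA -expnS.
(* The backward walk from [v] enters a loop at step [i]. The label there is periodic, and the label
   at [v] is one of its powers. The period depends on the walk only, so one [L] serves all
   labellings. *)
have /trajectP[i lt_i loop] := looping_order p v.
exists (fingraph.order p v - i); first by rewrite subn_gt0.
move=> phi phiE.
have period : (phi (iter i p v) ^+ (2 ^ (fingraph.order p v - i))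
               = phi (iter i p v))%g.
  rewrite [RHS](iterE _ phiE (fingraph.order p v - i)).
  by rewrite -iterD subnK ?(ltnW lt_i) // loop.
by rewrite [phi v](iterE _ phiE i) -expgnA mulnC expgnA period.
Qed.

Hypothesis nosrc : forall v : G, ~~ is_source v.

Lemma squaring_exp2n_inj phi psi v n : squaring phi -> squaring psi ->
  (phi v ^+ (2 ^ n) = psi v ^+ (2 ^ n))%g -> phi v = psi v.
Proof.
move=> phiE psiE; have [[//|L] _ vE] := squaring_periodic v nosrc.
elim: n => [|n IHn] e; first by rewrite !expg1 in e.
(* Raising to the power [2 ^ L] undoes one squaring, the period being [L.+1] for both labellings. *)
apply: IHn; rewrite -(vE _ (squaring_exp (2 ^ n) phiE)).
rewrite -(vE _ (squaring_exp (2 ^ n) psiE)) expnS !expgnA.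
by rewrite expnSr !expgnA in e; rewrite e.
Qed.

(** Equality propagates along a path: by squaring on forward edges, by uniqueness of square roots on
    backward ones. *)
Lemma squaring_eq phi psi (r : G) : connected G ->
  squaring phi -> squaring psi -> phi r = psi r -> phi =1 psi.
Proof.
move=> [_ conn] phiE psiE er v; have [p pp <-] := conn r v.
elim: p r er pp => [|[e w] p IHp] r er //= /and3P[ew e_rw pp].
apply: IHp pp; case/pred2P: e_rw ew => -> /= rw.
  by rewrite (phiE _ _ rw) (psiE _ _ rw) er.
by apply: (@squaring_exp2n_inj _ _ _ 1) => //; rewrite -(phiE _ _ rw) -(psiE _ _ rw).
Qed.

(** Here [n] counts the forward and [m] the backward steps; keeping both exponents avoids extracting
    roots. *)
Lemma squaring_path phi (u : G) p : squaring phi -> is_path u p ->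
  exists m n : nat, path_balance u p = (n%:Z - m%:Z)%R /\
    (phi (path_end u p) ^+ (2 ^ m) = phi u ^+ (2 ^ n))%g.
Proof.
move=> phiE; elim: p u => [|[e v] p IHp] u /=; first by exists 0, 0.
case/and3P=> ew e_uv /IHp[m [n [-> pE]]]; rewrite -[path_end u _]/(path_end v p).
(* A loop fits both directions; this test makes it a forward step, as in the balance. *)
have [e_uvE | ne_uv] := eqVneq e (u, v).
  exists m, n.+1; rewrite pE e_uvE xpair_eqE; split; last first.
    by rewrite (phiE u) ?expnS ?expgnA //; move: ew; rewrite e_uvE.
  by case: (eqVneq u v) => //= _; lia.
move: e_uv; rewrite (negPf ne_uv) /= => /eqP e_vu; move: ne_uv.
rewrite e_vu xpair_eqE eqxx (eq_sym v) andbb => -> /=.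
exists m.+1, n; split; first by lia.
by rewrite expnSr expgnA pE (phiE v u) -?expgnA 1?mulnC //; move: ew; rewrite e_vu.
Qed.

Lemma squaring_cycle phi (u : G) p : squaring phi -> is_cycle u p ->
  (phi u ^+ (2 ^ `|path_balance u p|%N) = phi u)%g.
Proof.
move=> phiE /andP[/(squaring_path phiE)[m [n [-> pE]]] /eqP endE].
move: pE; rewrite {}endE; wlog le_mn : m n / m <= n.
  by have /orP[? /(_ m n)|? /(_ n m)] := leq_total m n; [|rewrite distnC]; auto.
rewrite -{1}(subnK le_mn) expnD expgnA => /esym e.
rewrite distnEl //.
exact: (squaring_exp2n_inj (squaring_exp (2 ^ (n - m)) phiE) phiE e).
Qed.

Lemma squaring_exp_balance phi (u : G) : connected G -> squaring phi ->
  (phi u ^+ (2 ^ balance G) = phi u)%g.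
Proof.
move=> connG phiE; pose fixes k := (phi u ^+ (2 ^ k) == phi u)%g.
have [L L_gt0 LE] := squaring_periodic u nosrc.
have ex_d : exists d, (0 < d) && fixes d.
  by exists L; rewrite L_gt0 /fixes LE ?eqxx.
case: (ex_minnP ex_d) => d /andP[d_gt0 /eqP fix_d] d_min.
have fixM q : (phi u ^+ (2 ^ (q * d)) = phi u)%g.
  by elim: q => [|q IHq]; rewrite ?expg1 // mulSn expnD expgnA fix_d.
have /dvdnP[q ->] : d %| balance G; last exact: fixM.
apply: gcd_set_greatest => _ [v [p [cp ->]]].
have fix_v := squaring_cycle phiE cp; set k := `|_|%N in fix_v *.
(* The labelling and its [2 ^ k]-th power agree at [v], hence everywhere, so the cycle need not pass
   through [u]. *)
have fix_k : (phi u ^+ (2 ^ k) = phi u)%g.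
  exact: (squaring_eq connG (squaring_exp (2 ^ k) phiE) phiE fix_v u).
rewrite /dvdn; case: posnP => // mod_gt0.
(* A nonzero remainder would contradict the minimality of [d]. *)
have fix_mod : fixes (k %% d).
  by apply/eqP; rewrite -{2}fix_k {2}(divn_eq k d) expnD expgnA fixM.
by have := d_min (k %% d); rewrite mod_gt0 fix_mod leqNgt ltn_pmod // => /(_ isT).
Qed.

End Squaring.

Section BasePoint.
Variables (F : fieldType) (G : digraph) (r : G).
Hypotheses (connG : connected G) (nosrc : forall v : G, ~~ is_source v).

Let N := 2 ^ balance G - 1.

Lemma mu_balanceP (T : groupType) (x : T) :
  (x ^+ N = 1)%g <-> (x ^+ (2 ^ balance G) = x)%g.
Proof.
rewrite -(subnK (expn_gt0 2 (balance G))) -/N expgnDr expg1.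
by split=> [->|/(canRL (mulgK _))->]; rewrite ?mul1g ?mulgV.
Qed.

Lemma mu_predP (A : comPzRingType) (x : units A) :
  reflect (x ^+ N = 1)%g (mu_pred N A x).
Proof. by rewrite /mu_pred /= -uvalX -(uval1 A) (inj_eq (@uval_inj A)); apply: eqP. Qed.

Lemma diag_squaring (A : comPzRingType) (phi : diag_type G A) :
  squaring (diag_val phi).
Proof. exact/diag_predP/(valP phi). Qed.

Fact base_value_mu (A : comPzRingType) (phi : diag_type G A) :
  mu_pred N A (diag_val phi r).
Proof.
apply/mu_predP/mu_balanceP.
by apply: squaring_exp_balance => //; apply: diag_squaring.
Qed.

Definition base_value (A : comPzRingType) (phi : diag_type G A) : mu_type N A :=
  Mu (base_value_mu phi).

Fact base_valueM (A : comPzRingType) :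
  {morph @base_value A : phi psi / (phi * psi)%g}.
Proof. by move=> phi psi; apply: val_inj; rewrite /= ffunE. Qed.

HB.instance Definition _ (A : comPzRingType) :=
  isMultiplicative.Build (diag_type G A) (mu_type N A) (@base_value A)
    (@base_valueM A).

Lemma base_value_inj (A : comPzRingType) : injective (@base_value A).
Proof.
move=> phi psi [e]; apply: val_inj; apply/ffunP.
by apply: (@squaring_eq _ _ nosrc _ _ r) => //; apply: diag_squaring.
Qed.

Lemma base_value_surj (A : comPzRingType) (x : mu_type N A) :
  exists phi, base_value phi = x.
Proof.
have [h [hr hE]] := potential_mod_balance r connG.
have b_gt0 := balance_gt0 connG nosrc.
have [k kE] : exists k : G -> nat, forall v, Posz (k v) = (h v %% balance G)%Z.
  by exists (fun v => `|(h v %% balance G)%Z|%N) => v; rewrite gez0_abs ?modz_ge0; lia.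
have /mu_predP/mu_balanceP x_bal := valP x.
have x_mul q : (val x ^+ (2 ^ (q * balance G)) = val x)%g.
  by elim: q => [|q IHq]; rewrite ?expg1 // mulSn expnD expgnA x_bal.
(* Only the residue of [n] matters, so the congruences on [h] become the squaring relations. *)
have x_mod n : (val x ^+ (2 ^ n) = val x ^+ (2 ^ (n %% balance G)))%g.
  by rewrite {1}(divn_eq n (balance G)) expnD expgnA x_mul.
have phiP : diag_pred G A [ffun v => (val x ^+ (2 ^ k v))%g].
  apply/diag_predP => v w vw; rewrite !ffunE -expgnA -expnSr.
  rewrite x_mod [RHS]x_mod; congr (_ ^+ (2 ^ _))%g; apply/eqP.
  rewrite -eqz_nat -!modz_nat -addn1 PoszD !kE modz_mod modzDml.
  by rewrite eqz_mod_dvd hE.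
exists (Diagonal phiP); apply: val_inj; rewrite /= ffunE.
(* The normalisation of [h] at [r] makes the label there [x] itself. *)
have [k0] : Posz (k r) = 0%R by rewrite kE; apply/dvdz_mod0P.
by rewrite k0 expg1.
Qed.

Lemma Diag_mu_isomorphic : ags_isomorphic (Diag F G) (mu F N).
Proof.
exists (fun A => @base_value A : {multiplicative Diag F G A -> mu F N A}).
split=> [A|A A' f phi].
  have surj x : {phi | @base_value A phi = x} by apply/cid/base_value_surj.
  exists (fun x => sval (surj x)) => [phi|x]; last exact: svalP (surj x).
  exact/base_value_inj/(svalP (surj _)).
by apply: val_inj; apply: uval_inj; rewrite /= ffunE.
Qed.

End BasePoint.

Theorem theorem2p7 (F : fieldType) (G : digraph) :
  connected G ->
  (forall v : G, ~~ is_source v) ->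
  ags_isomorphic (Diag F G) (mu F (2 ^ balance G - 1)%N).
Proof.
move=> connG nosrc; have [/card_gt0P[r _] _] := connG.
exact: (Diag_mu_isomorphic F r).
Qed.
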